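(* Let $L$ be a self-adjoint positive definite operator in a Hilbert space $\mathcal{H}$, let $D=L^{1/2}$, let $\alpha>0$, $1\le q\le\infty$ and $a>1$. There exist constants $c_1>0$, $c_2>0$, independent of $f$, such that the following holds. A vector $f\in\mathcal{H}$ belongs to $\mathbf{B}^{\alpha}_{2,q}(D)$ if and only if there exists a sequence of vectors $f_k=f_k(f)\in PW_{a^k}(D)$, $k=0,1,2,\dots$, such that the series $\sum_k f_k$ converges to $f$ in $\mathcal{H}$ and the following inequalities hold, with all quantities finite: $$c_1\|f\|_{\mathbf{B}^\alpha_{2,q}(D)}\le\left(\sum_{k=0}^\infty\left(a^{k\alpha}\|f_k\|\right)^q\right)^{1/q}\le c_2\|f\|_{\mathbf{B}^\alpha_{2,q}(D)}.$$ For $q=\infty$ the middle expression is read as $\sup_{k\ge0}a^{k\alpha}\|f_k\|$.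
   Context: $\|\cdot\|$ is the norm of the Hilbert space $\mathcal{H}$. $L$ may be unbounded; $D=L^{1/2}$ is its positive square root, a self-adjoint operator with spectrum in $[0,\infty)$. Spectral transform: by the spectral theorem there are a direct integral of Hilbert spaces $X=\int X(\lambda)\,dm(\lambda)$ over $[0,\infty)$ and a unitary operator $\mathcal{F}_D:\mathcal{H}\to X$ that maps the domain of $D^k$ onto $\{x\in X:\lambda^kx\in X\}$ with $\mathcal{F}_D(D^kf)=\lambda^k\mathcal{F}_Df$. Paley-Wiener space: for $\omega>0$, $PW_\omega(D)$ is the set of $f\in\mathcal{H}$ such that $\mathcal{F}_Df$ has support in $[0,\omega]$ (i.e. $f$ lies in the range of the spectral projection of $D$ for $[0,\omega]$). Besov space: $\mathbf{B}^\alpha_{2,q}(D)=(\mathcal{H},\mathcal{D}(D^r))^K_{\alpha/r,q}$, the real interpolation space given by Peetre's $K$-functor, where $r$ is any natural number with $r>\alpha$ and $\mathcal{D}(D^r)$ is the domain of $D^r$ with the graph norm $\|f\|+\|D^rf\|$. That is, with $K(f,t)=\inf\{\|f_0\|+t(\|f_1\|+\|D^rf_1\|): f=f_0+f_1,\ f_0\in\mathcal{H},\ f_1\in\mathcal{D}(D^r)\}$, the norm is $\left(\int_0^\infty(t^{-\alpha/r}K(f,t))^q\frac{dt}{t}\right)^{1/q}$ (for $q=\infty$: $\sup_{t>0}t^{-\alpha/r}K(f,t)$), and the space consists of all $f\in\mathcal{H}$ for which it is finite (set $\|f\|_{\mathbf{B}^\alpha_{2,q}(D)}=\infty$ otherwise);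 different choices of $r$ give equivalent norms. *)

(* Defs.v *)
From mathcomp Require Import all_boot all_order all_algebra.
From mathcomp Require Import complex.
From mathcomp Require Import all_classical all_reals all_analysis.

Set Implicit Arguments.
Unset Strict Implicit.
Unset Printing Implicit Defensive.

Import Order.TTheory GRing.Theory Num.Theory.
Import numFieldNormedType.Exports.

Local Open Scope classical_set_scope.
Local Open Scope ring_scope.
Local Open Scope complex_scope.

(* A complex Hilbert space is a [completeNormedModType R[i]] together with an
   inner product [form] that induces its norm.  As for every
   [{dot _ for Num.conj}], [form] is linear in its first argument. *)
Definition induces_norm (R : realType) (H : completeNormedModType R[i])
    (form : {dot H for Num.conj}) : Prop :=
  forall f : H, form f f = `|f| ^+ 2.

(* The norm of a normed module over [R[i]] takes its values in [R[i]]. *)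
Definition hnorm (R : realType) (H : normedModType R[i]) (f : H) : R :=
  complex.Re `|f|.

(* The values of [op_fun] outside of [op_dom] are irrelevant. *)
Record unbounded_op (R : realType) (H : lmodType R[i]) := UnboundedOp {
  op_dom : set H;
  op_fun :> H -> H;
  op_dom0 : op_dom 0;
  op_domP : forall (c : R[i]) f g,
    op_dom f -> op_dom g -> op_dom (c *: f + g);
  op_linear : forall (c : R[i]) f g,
    op_dom f -> op_dom g -> op_fun (c *: f + g) = c *: op_fun f + op_fun g
}.

Definition pow_dom (R : realType) (H : lmodType R[i]) (A : unbounded_op H)
    (k : nat) : set H :=
  [set f | forall i, (i < k)%N -> op_dom A (iter i A f)].

Section Operators.
Context (R : realType) (H : completeNormedModType R[i])
  (form : {dot H for Num.conj}).

(* The graph of the adjoint of [A]. *)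
Definition adjoint_graph (A : unbounded_op H) : set (H * H) :=
  [set gh | forall f, op_dom A f -> form (A f) gh.1 = form f gh.2].

Definition self_adjoint (A : unbounded_op H) : Prop :=
  dense (op_dom A) /\
  forall g h, adjoint_graph A (g, h) <-> op_dom A g /\ A g = h.

Definition positive_definite (A : unbounded_op H) : Prop :=
  forall f, op_dom A f -> f != 0 -> 0 < form (A f) f.

(* [D] is the positive self-adjoint operator with [D^2 = L], domains
   included. *)
Definition is_positive_sqrt (D L : unbounded_op H) : Prop :=
  [/\ self_adjoint D,
      forall f, op_dom D f -> 0 <= form (D f) f,
      op_dom L = pow_dom D 2 &
      forall f, op_dom L f -> L f = D (D f)].

Definition orthogonal_projection (P : H -> H) : Prop :=
  [/\ linear P, forall f, P (P f) = P f &
      forall f g, form (P f) g = form f (P g)].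

Definition scalar_spectral_measure (E : set R -> H -> H) (f : H)
    (mu : {measure set (measurableTypeR R) -> \bar R}) : Prop :=
  forall A : set R, measurable A -> mu A = (hnorm (E A f) ^+ 2)%:E.

(* A projection-valued measure on the Borel sets of [R].  Its countable
   additivity is that of the set functions [A |-> |E A f|^2]. *)
Definition projection_valued_measure (E : set R -> H -> H) : Prop :=
  [/\ forall A : set R, measurable A -> orthogonal_projection (E A),
      forall f, E setT f = f,
      forall A B : set R, measurable A -> measurable B ->
        forall f, E (A `&` B) f = E A (E B f) &
      forall f, exists mu, scalar_spectral_measure E f mu].

(* [E] is the spectral measure on [0, +oo[ that diagonalizes [D]: a vector [f]
   is in the domain of [D^k] iff [x^k] is square integrable for [|E(dx) f|^2],
   and [D^k] acts as multiplication by [x^k] in the spectral variable.  The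
   latter is given by the quadratic form [(D^k f, f)], from which the sesquilinear
   form follows by polarization. *)
Definition spectral_measure_of (D : unbounded_op H) (E : set R -> H -> H) :
    Prop :=
  [/\ projection_valued_measure E,
      forall f, E [set` `[0, +oo[] f = f,
      forall k f mu, scalar_spectral_measure E f mu ->
        pow_dom D k f <-> (\int[mu]_x (x ^+ k.*2)%:E < +oo)%E &
      forall k f mu, scalar_spectral_measure E f mu -> pow_dom D k f ->
        form (iter k D f) f = (\int[mu]_x (x ^+ k))%R%:C].

Definition Paley_Wiener (E : set R -> H -> H) (w : R) : set H :=
  range (E [set` `[0, w]]).

Definition K_functional (D : unbounded_op H) (r : nat) (f : H) (t : R) : R :=
  inf [set x | exists f0 f1 : H, [/\ f = f0 + f1, pow_dom D r f1 &
    x = hnorm f0 + t * (hnorm f1 + hnorm (iter r D f1))]].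

(* [q] ranges over [1, +oo], so that the last case is [q = +oo]. *)
Definition besov_norm (D : unbounded_op H) (alpha : R) (q : \bar R) (r : nat)
    (f : H) : \bar R :=
  let g t := t `^ (- (alpha / r%:R)) * K_functional D r f t in
  match q with
  | q'%:E => ((\int[lebesgue_measure]_(t in `]0%R, +oo[)
                 (g t `^ q' / t)%:E) `^ q'^-1)%E
  | _ => ereal_sup [set (g t)%:E | t in [set` `]0, +oo[]]
  end.

Definition besov (D : unbounded_op H) (alpha : R) (q : \bar R) (r : nat) :
    set H :=
  [set f | (besov_norm D alpha q r f < +oo)%E].

Definition weighted_seq_norm (a alpha : R) (q : \bar R) (u : nat -> H) :
    \bar R :=
  let g k := a `^ (k%:R * alpha) * hnorm (u k) in
  match q with
  | q'%:E => ((\sum_(0 <= k <oo) (g k `^ q')%:E) `^ q'^-1)%E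
  | _ => ereal_sup (range (fun k => (g k)%:E))
  end.

End Operators.

(* Main.v *)
(* The vectors are the spectral bands f_0 = E[0, 1] f and
   f_k = E[0, a^k] f - E[0, a^(k-1)] f.  Put A = a^r, theta = alpha / r and
   b_k = a^(k alpha) |f_k|.
   A decomposition f = g_0 + g_1 and the reverse Bernstein inequality
   a^((k-1) r) |(g_1)_k| <= |D^r g_1| give |f_k| <= A K(f, t) for t >= A^-k, so
   b_k is bounded by t^-theta K(f, t) on the k-th of the disjoint intervals
   ]A^-k, A^(1-k)[, each of which has dt/t-measure bounded below.
   Conversely, subadditivity of K and the Bernstein inequality
   |D^r f_k| <= a^(k r) |f_k| give
   t^-theta K(f, t) <= 2 sum_k phi(t A^k) b_k, phi(s) = min(1, s) s^-theta.
   Since phi <= 16 psi^2 for a kernel psi <= 1 whose sums over t A^k and whose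
   integrals against dt/t are bounded, and psi b_k <= (sum_j psi b_j^q)^(1/q),
   one gets (t^-theta K(f, t))^q <= C sum_k psi(t A^k) b_k^q; integrate this. *)

Require Import Defs.
From mathcomp Require Import all_boot all_order all_algebra.
From mathcomp Require Import complex.
From mathcomp Require Import all_classical all_reals all_analysis.
From mathcomp Require Import measurable_realfun ring lra.
Import Order.TTheory GRing.Theory Num.Theory.
Import numFieldNormedType.Exports.
Local Open Scope classical_set_scope.
Local Open Scope ring_scope.
Local Open Scope complex_scope.

Set Implicit Arguments.
Unset Strict Implicit.

(** * Real-valued norm and real inner product of the complex Hilbert space *)

Section InnerProduct.
Context {R : realType} {H : completeNormedModType R[i]}
  (form : {dot H for Num.conj}).
Hypothesis form_norm : induces_norm form.
Implicit Types f g h : H.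

Lemma normE f : `|f| = (hnorm f)%:C.
Proof. by rewrite /hnorm RRe_real// normr_real. Qed.

Lemma hnorm_ge0 f : 0 <= hnorm f.
Proof. by rewrite -ler0c -normE. Qed.

Lemma hnorm0 : hnorm (0 : H) = 0.
Proof. by rewrite /hnorm normr0. Qed.

Lemma ler_hnormD f g : hnorm (f + g) <= hnorm f + hnorm g.
Proof. by rewrite -lecR rmorphD /= -!normE ler_normD. Qed.

Lemma hnorm_eq0 f : hnorm f = 0 -> f = 0.
Proof. by move=> f0; apply/eqP; rewrite -normr_eq0 normE f0. Qed.

(** The real part makes [form] a symmetric real bilinear form with the same norm, so orders and
    squares can be handled in [R]. *)
Definition ip f g : R := complex.Re (form f g).

Lemma ipDl f g h : ip (f + g) h = ip f h + ip g h.
Proof. by rewrite /ip linearDl raddfD. Qed.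

Lemma ipBl f g h : ip (f - g) h = ip f h - ip g h.
Proof. by rewrite /ip linearBl raddfB. Qed.

Lemma ipC f g : ip f g = ip g f.
Proof. by rewrite /ip hermC /= expr0 mul1r; case: (form g f). Qed.

Lemma ipDr f g h : ip f (g + h) = ip f g + ip f h.
Proof. by rewrite ipC ipDl !(ipC f). Qed.

Lemma ipBr f g h : ip f (g - h) = ip f g - ip f h.
Proof. by rewrite ipC ipBl !(ipC f). Qed.

Lemma ipff f : ip f f = hnorm f ^+ 2.
Proof. by rewrite /ip form_norm normE -rmorphXn. Qed.

(** Squaring the triangle inequality for [f + g] and cancelling the squares leaves this one-sided
    Cauchy-Schwarz inequality. *)
Lemma ip_le f g : ip f g <= hnorm f * hnorm g.
Proof.
have /(@lerXn2r _ 2 _ _ (hnorm_ge0 _)) := ler_hnormD f g.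
rewrite nnegrE addr_ge0 ?hnorm_ge0// => /(_ isT).
rewrite -!ipff ipDl !ipDr !ipff (ipC g f) sqrrD; lra.
Qed.

End InnerProduct.

(** * Domains, linearity and symmetry of the powers of an unbounded operator *)

Section PowersOfSelfAdjoint.
Context {R : realType} {H : completeNormedModType R[i]}
  (form : {dot H for Num.conj}) (D : unbounded_op H).

Lemma pow_domW (m n : nat) (f : H) : (m <= n)%N -> pow_dom D n f -> pow_dom D m f.
Proof. by move=> mn fn i im; apply: fn; apply: leq_trans mn. Qed.

Lemma pow_domS (n : nat) (f : H) :
  pow_dom D n.+1 f <-> pow_dom D n f /\ op_dom D (iter n D f).
Proof.
split=> [fn|[fn fn1] i]; first by split; [exact: pow_domW fn|exact: fn].
by rewrite ltnS leq_eqVlt => /predU1P[->//|/fn].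
Qed.

Lemma pow_dom_iter (m n : nat) (f : H) :
  pow_dom D (m + n) f -> pow_dom D m (iter n D f).
Proof. by move=> fmn i im; rewrite -iterD; apply: fmn; rewrite ltn_add2r. Qed.

(** Both claims go through one induction: linearity of the n-th iterate is what puts it in the
    domain of [D] at the next step. *)
Lemma pow_domP n (c : R[i]) (f g : H) : pow_dom D n f -> pow_dom D n g ->
  pow_dom D n (c *: f + g) /\
  iter n D (c *: f + g) = c *: iter n D f + iter n D g.
Proof.
elim: n => [|n IH]; first by split => // i.
move=> /pow_domS[fn fn1] /pow_domS[gn gn1].
have [h1 h2] := IH fn gn; split; last by rewrite !iterS h2 op_linear.
by apply/pow_domS; split => //; rewrite h2; exact: op_domP.
Qed.

Lemma pow_domD n (f g : H) : pow_dom D n f -> pow_dom D n g ->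
  pow_dom D n (f + g).
Proof. by move=> fn gn; have [] := pow_domP 1 fn gn; rewrite scale1r. Qed.

Lemma iter_opD n (f g : H) : pow_dom D n f -> pow_dom D n g ->
  iter n D (f + g) = iter n D f + iter n D g.
Proof. by move=> fn gn; have [_] := pow_domP 1 fn gn; rewrite !scale1r. Qed.

Lemma pow_dom0 n : pow_dom D n (0 : H) /\ iter n D (0 : H) = 0.
Proof.
elim: n => [|n [d0 i0]]; first by split => // i.
have D0 : D 0 = 0.
  by have := op_linear (-1) (op_dom0 D) (op_dom0 D); rewrite scaler0 addr0 scaleN1r addNr.
split; last by rewrite iterS i0.
by apply/pow_domS; rewrite i0; split => //; exact: op_dom0.
Qed.

Lemma pow_domB n (f g : H) : pow_dom D n f -> pow_dom D n g ->
  pow_dom D n (f - g).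
Proof. by move=> fn gn; have [] := pow_domP (-1) gn fn; rewrite scaleN1r addrC. Qed.

Lemma iter_self_adjoint n (f g : H) : self_adjoint form D ->
  pow_dom D n f -> pow_dom D n g -> form (iter n D f) g = form f (iter n D g).
Proof.
move=> [_ sa]; elim: n f g => // n IH f g fn gn.
have /pow_domS[gn' gn1] := gn.
have f1 : op_dom D f by exact: (fn 0%N).
rewrite iterSr IH//; last by apply: (@pow_dom_iter n 1); rewrite addn1.
(* Read from right to left, [sa] puts this pair of the graph of [D] into the adjoint graph, which is
   the symmetry of [D]. *)
have /sa : op_dom D (iter n D g) /\ D (iter n D g) = iter n.+1 D g by [].
exact.
Qed.

End PowersOfSelfAdjoint.

(** * Spectral projections and moments of the scalar spectral measures *)

Section SpectralMeasure.
Context {R : realType} {H : completeNormedModType R[i]}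
  (form : {dot H for Num.conj}) (D : unbounded_op H) (E : set R -> H -> H).
Hypotheses (form_norm : induces_norm form) (D_sa : self_adjoint form D)
  (E_D : spectral_measure_of form D E).
Implicit Types (f g h u : H) (A B : set R) (w s : R).

Local Notation ip := (ip form).
Local Notation P w := (E [set` `[0, w]]).

Let E_pvm : projection_valued_measure form E. Proof. by have [] := E_D. Qed.

Lemma subset_itv0 s w : s <= w -> [set` `[0, s]] `<=` [set` `[0, w]].
Proof. by move=> sw x /=; rewrite !in_itv/= => /andP[-> /le_trans ->]. Qed.

Lemma E_orth A : measurable A -> orthogonal_projection form (E A).
Proof. by move=> mA; have [/(_ A mA)] := E_pvm. Qed.

Lemma ED A f g : measurable A -> E A (f + g) = E A f + E A g.
Proof.
by move=> mA; have [/(_ 1 f g) EA _ _] := E_orth mA; rewrite !scale1r in EA.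
Qed.

Lemma EB A f g : measurable A -> E A (f - g) = E A f - E A g.
Proof.
move=> mA; have [/(_ (-1) g f) EA _ _] := E_orth mA.
by rewrite !scaleN1r ![- _ + _]addrC in EA.
Qed.

Lemma EI A B f : measurable A -> measurable B -> E A (E B f) = E (A `&` B) f.
Proof. by move=> mA mB; have [_ _ /(_ A B mA mB f)] := E_pvm. Qed.

Lemma E_ip A f g : measurable A -> ip (E A f) g = ip f (E A g).
Proof. by move=> mA; have [_ _ EA] := E_orth mA; rewrite /ip EA. Qed.

(** Pythagoras for the orthogonal splitting of [f] by the projection [E A]. *)
Lemma hnormBE A f : measurable A ->
  hnorm (f - E A f) ^+ 2 = hnorm f ^+ 2 - hnorm (E A f) ^+ 2.
Proof.
move=> mA; rewrite -!(ipff form_norm) ipBr !ipBl -(E_ip f) // (E_ip f f)//.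
by rewrite !E_ip// EI// setIid; ring.
Qed.

Lemma hnormE_le A f : measurable A -> hnorm (E A f) <= hnorm f.
Proof.
move=> mA; rewrite -(@ler_pXn2r _ 2)// ?nnegrE ?hnorm_ge0//.
by rewrite -subr_ge0 -hnormBE// sqr_ge0.
Qed.

Lemma E_set0 f : E set0 f = 0.
Proof.
have [_ _ _ /(_ f)[mu /(_ set0 measurable0)]] := E_pvm.
rewrite measure0 => -[] /esym/eqP; rewrite sqrf_eq0 => /eqP.
exact: hnorm_eq0.
Qed.

Lemma E_setC A f : measurable A -> E A f = f -> E (~` A) f = 0.
Proof. by move=> mA <-; rewrite EI ?setICl ?E_set0//; exact: measurableC. Qed.

Lemma E_nneg f : E [set` `[0, +oo[] f = f.
Proof. by have [_ + _ _] := E_D; exact. Qed.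

Lemma spectral_measure_ex f : {mu : {measure set (measurableTypeR R) -> \bar R} |
  scalar_spectral_measure E f mu}.
Proof. by apply: cid; have [_ _ _] := E_pvm. Qed.

Section Moments.
Variables (f : H) (mu : {measure set (measurableTypeR R) -> \bar R}).
Hypothesis mu_f : scalar_spectral_measure E f mu.

Lemma spectral_measure_setT : mu setT = (hnorm f ^+ 2)%:E.
Proof. by rewrite mu_f//; have [_ -> _ _] := E_pvm. Qed.

Lemma measurable_normX n :
  measurable_fun setT
    (fun x : measurableTypeR R => (`|x| ^+ n)%:E).
Proof.
apply/measurable_EFinP; apply: measurable_funX.
exact: normr_measurable.
Qed.

Lemma spectral_measure_supp A : measurable A -> E A f = f -> mu (~` A) = 0%E.
Proof.
move=> mA EA.
by rewrite mu_f ?E_setC ?hnorm0 ?expr0n//; exact: measurableC.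
Qed.

Lemma integral_supp n A : measurable A -> mu (~` A) = 0%E ->
  (\int[mu]_x (`|x| ^+ n)%:E = \int[mu]_(x in A) (`|x| ^+ n)%:E)%E.
Proof.
move=> mA EA; rewrite (@ge0_negligible_integral _ (measurableTypeR R) _ _ _ (~` A))//.
- by rewrite setTD setCK.
- exact: measurableC.
- exact: measurable_normX.
Qed.

(** The negative half-line is null for [mu], so moments may be treated as integrals of nonnegative
    functions. *)
Lemma integral_abs n : (\int[mu]_x (x ^+ n)%:E = \int[mu]_x (`|x| ^+ n)%:E)%E.
Proof.
apply: ae_eq_integral => //.
- apply/measurable_EFinP; exact: exprn_measurable.
- exact: measurable_normX.
exists (~` [set` `[0, +oo[]); split.
- exact: measurableC.
- by rewrite spectral_measure_supp// E_nneg.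
move=> x /= nx x0; apply: nx => _; rewrite ger0_norm//.
by move: x0; rewrite in_itv/= andbT.
Qed.

Lemma pow_dom_moment n : pow_dom D n f <->
  (\int[mu]_x (`|x| ^+ n.*2)%:E < +oo)%E.
Proof. by have [_ _ /(_ n _ _ mu_f) -> _] := E_D; rewrite integral_abs. Qed.

Lemma moment_fin n : pow_dom D n f ->
  (\int[mu]_x (`|x| ^+ n)%:E \is a fin_num)%E.
Proof.
move=> /pow_dom_moment fn; rewrite ge0_fin_numE; last exact: integral_ge0.
(* The domain only controls the moment of order 2n. As [mu] is finite, the bound |x|^n <= 1 +
   |x|^(2n) gives the one of order n. *)
have : (\int[mu]_x (1 + `|x| ^+ n.*2)%:E < +oo)%E.
  under eq_integral do rewrite EFinD.
  rewrite ge0_integralD//; last exact: measurable_normX.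
  by rewrite lte_add_pinfty// integral_cst//= mul1e spectral_measure_setT ltry.
apply: le_lt_trans; apply: ge0_le_integral => //.
- exact: measurable_normX.
- apply/measurable_EFinP/measurable_funD => //; apply/measurable_EFinP.
  exact: measurable_normX.
move=> x _; rewrite lee_fin -muln2 exprM.
have := sqr_ge0 (`|x| ^+ n - 1); have := exprn_ge0 n (normr_ge0 x); nra.
Qed.

(** The real integral in [spectral_measure_of] is the finite part of the extended one; [moment_fin]
    makes the two agree. *)
Lemma ip_moment n : pow_dom D n f ->
  (\int[mu]_x (`|x| ^+ n)%:E = (ip (iter n D f) f)%:E)%E.
Proof.
move=> fn; rewrite /ip; have [_ _ _ /(_ n _ _ mu_f fn) ->] := E_D.
by rewrite /= /Rintegral integral_abs fineK// moment_fin.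
Qed.

End Moments.

(** * Bernstein inequality and its reverse for spectral bands *)

Lemma pow_dom_bounded w n f : P w f = f -> pow_dom D n f.
Proof.
move=> fw; have [mu mu_f] := spectral_measure_ex f.
rewrite (pow_dom_moment mu_f) (@integral_supp _ _ [set` `[0, w]])//; last first.
  exact: (spectral_measure_supp mu_f).
apply: (@le_lt_trans _ _ (\int[mu]_(x in [set` `[0%R, w]]) (w ^+ n.*2)%:E)%E).
  apply: ge0_le_integral => //.
  - by apply: measurable_funTS; exact: measurable_normX.
  - move=> x /=; rewrite in_itv /= => /andP[x0 xw].
    by rewrite lee_fin lerXn2r ?nnegrE ?(ger0_norm x0)// (le_trans x0).
rewrite integral_cst//= mu_f// ltry//.
Qed.

(** By symmetry |D^n f|^2 = (D^(2n) f, f), a moment of order 2n of a measure carried by [0, w] with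
    total mass |f|^2. *)
Lemma bernstein w n f : 0 <= w -> P w f = f ->
  hnorm (iter n D f) <= w ^+ n * hnorm f.
Proof.
move=> w0 fw; have [mu mu_f] := spectral_measure_ex f.
rewrite -(@ler_pXn2r _ 2)// ?nnegrE ?hnorm_ge0//; last first.
  by rewrite mulr_ge0 ?hnorm_ge0 ?exprn_ge0.
have dom m : pow_dom D m f by exact: pow_dom_bounded fw.
have -> : hnorm (iter n D f) ^+ 2 = ip (iter (n + n) D f) f.
  rewrite iterD -(ipff form_norm) /ip; congr complex.Re.
  rewrite [RHS](iter_self_adjoint D_sa)//; exact: pow_dom_iter.
rewrite -lee_fin -(ip_moment mu_f)// (@integral_supp _ _ [set` `[0, w]])//; last first.
  exact: (spectral_measure_supp mu_f).
apply: (@le_trans _ _ (\int[mu]_(x in [set` `[0%R, w]]) (w ^+ (n + n))%:E)%E).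
  apply: ge0_le_integral => //.
  - by apply: measurable_funTS; exact: measurable_normX.
  - move=> x /=; rewrite in_itv /= => /andP[x0 xw].
    by rewrite lee_fin lerXn2r ?nnegrE ?(ger0_norm x0)// (le_trans x0).
by rewrite integral_cst//= mu_f// fw -EFinM exprMn -exprM addnn -muln2.
Qed.

(* The spectral measure of [h + u] is the sum of those of [h] and [u], so the
   cross terms of the quadratic form of [D^n] cancel. *)
Lemma iter_orthogonal n h u : pow_dom D n h -> pow_dom D n u ->
  (forall A, measurable A -> ip (E A h) (E A u) = 0) ->
  ip (iter n D u) h = 0.
Proof.
move=> hn un hu0.
have [mu mu_h] := spectral_measure_ex h.
have [nu nu_u] := spectral_measure_ex u.
have mnu : scalar_spectral_measure E (h + u) (measure_add mu nu).
  move=> A mA; rewrite [LHS](measure_addE mu nu) mu_h// nu_u// -EFinD ED//; congr EFin.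
  rewrite -!(ipff form_norm) ipDl !ipDr (ipC _ (E A u)) hu0//; ring.
have := ip_moment mnu (pow_domD hn un).
rewrite ge0_integral_measure_add//; last exact: measurable_normX.
rewrite (ip_moment mu_h)// (ip_moment nu_u)// iter_opD// -EFinD => -[].
have -> : ip (iter n D u) h = ip (iter n D h) u.
  by rewrite ipC /ip (iter_self_adjoint D_sa).
rewrite ipDl !ipDr.
have -> : ip (iter n D u) h = ip (iter n D h) u.
  by rewrite ipC /ip (iter_self_adjoint D_sa).
lra.
Qed.

(** The measure of the band [h] lives on ]s, w], so s^n |h|^2 <= (D^n h, h). This equals (D^n g, h),
    because D^n (g - h) is orthogonal to [h], and Cauchy-Schwarz then allows division by |h|. *)
Lemma reverse_bernstein s w n g : 0 <= s -> s <= w -> pow_dom D n g ->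
  s ^+ n * hnorm (P w g - P s g) <= hnorm (iter n D g).
Proof.
move=> s0 sw gn; set h := P w g - P s g.
have sub := subset_itv0 sw.
have hw : P w h = h.
  by rewrite /h EB// !EI// setIid (setIidr sub).
have hs : P s h = 0.
  by rewrite /h EB// !EI// setIid (setIidl sub) subrr.
have [mu mu_h] := spectral_measure_ex h.
(* [hw] makes the complement of [0, w] null and [hs] makes [0, s] null; together they cover the
   complement of ]s, w]. *)
have supp : mu (~` [set` `]s, w]]) = 0%E.
  apply: (@subset_measure0 _ _ _ mu _ (~` [set` `[0, w]] `|` [set` `[0, s]])).
  - exact: measurableC.
  - by apply: measurableU => //; exact: measurableC.
  - move=> x /=; rewrite !in_itv/= => nx.
    have [[x0 xw]|] := pselect (0 <= x /\ x <= w).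
      right; rewrite x0 leNgt; apply/negP => sx; apply: nx; by rewrite sx xw.
    by move=> nx0; left => /andP.
  apply: (@null_set_setU _ (measurableTypeR R)) => //.
  - exact: measurableC.
  - exact: (spectral_measure_supp mu_h).
  - by rewrite mu_h// hs hnorm0 expr0n.
have hn : pow_dom D n h by exact: pow_dom_bounded hw.
have orth A : measurable A -> ip (E A h) (E A (g - h)) = 0.
  move=> mA; rewrite -E_ip// (EI h)// setIid.
  have -> : E A h = P w (E A g) - P s (E A g).
    by rewrite /h EB// !EI// !(setIC A).
  (* Removing the band leaves nothing between [s] and [w]: both sides equal [P s g]. *)
  have Ph : P w (g - h) = P s (g - h).
    by rewrite !(EB g)// hw hs subr0 /h opprB addrCA subrr addr0.
  rewrite ipBl (E_ip (E A g))// (E_ip (E A g))// Ph.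
  by rewrite subrr.
have gh0 := iter_orthogonal hn (pow_domB gn hn) orth.
have := ip_le form_norm (iter n D g) h.
rewrite -{1}(subrK h g) (iter_opD (pow_domB gn hn) hn) ipDl gh0 add0r.
have : s ^+ n * hnorm h ^+ 2 <= ip (iter n D h) h.
  rewrite -lee_fin -(ip_moment mu_h)// (@integral_supp _ _ [set` `]s, w]])//.
  have -> : (s ^+ n * hnorm h ^+ 2)%:E =
      (\int[mu]_(x in [set` `]s, w]]) (s ^+ n)%:E)%E.
    rewrite integral_cst//= EFinM; congr (_ * _)%E.
    rewrite -(spectral_measure_setT mu_h) -(setvU [set` `]s, w]]).
    rewrite (@measureU _ (measurableTypeR R)) ?setICl//; last exact: measurableC.
    by rewrite -[RHS]add0e; congr (_ + _)%E.
  apply: ge0_le_integral => //.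
  - by move=> x _; rewrite lee_fin exprn_ge0.
  - by apply: measurable_funTS; exact: measurable_normX.
  - move=> x /=; rewrite in_itv /= => /andP[sx xw].
    have x0 : 0 <= x := le_trans s0 (ltW sx).
    by rewrite lee_fin (ger0_norm x0) lerXn2r ?nnegrE// ltW.
move=> /le_trans /[apply].
have [->|h0] := eqVneq (hnorm h) 0; first by rewrite !mulr0 hnorm_ge0.
by rewrite expr2 mulrA ler_pM2r// lt0r h0 hnorm_ge0.
Qed.

(** * Decomposition of a vector into its spectral bands *)

Lemma cvg_proj a f : 1 < a -> P (a ^+ n) f @[n --> \oo] --> f.
Proof.
move=> a1; have a0 : 0 <= a by apply: ltW; apply: lt_trans a1.
have [mu mu_f] := spectral_measure_ex f.
pose F n := [set` `[0, a ^+ n]] : set (measurableTypeR R).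
have mF n : measurable (F n) by exact: (measurable_itv `[0, a ^+ n]).
have FU : \bigcup_n F n = [set` `[0, +oo[].
  apply/seteqP; split => x /=.
    by move=> [n _]; rewrite /F /= in_itv/= => /andP[x0 _]; rewrite in_itv/= x0.
  rewrite in_itv /= andbT => x0.
  (* Since a^-n tends to 0, some n has a^-n < 1 / (x + 1), hence x < a^n. *)
  have /cvgrPdist_lt /(_ (x + 1)^-1) : GRing.exp a^-1 @ \oo --> (0 : R).
    by apply: cvg_expr; rewrite ger0_norm ?invr_ge0// invf_lt1// (lt_trans _ a1).
  rewrite invr_gt0 ltr_wpDl// => /(_ isT)[n _ /(_ n (leqnn n))] /=.
  rewrite sub0r normrN ger0_norm ?exprn_ge0 ?invr_ge0// exprVn.
  rewrite ltf_pV2 ?posrE ?ltr_wpDl// ?exprn_gt0// ?(lt_trans _ a1)// => xa.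
  by exists n => //; rewrite /F /= in_itv/= x0 ltW// (lt_trans _ xa)// ltrDl.
(* Continuity from below gives |E[0, a^n] f|^2 --> |f|^2, and by [hnormBE] the gap is the squared
   distance to [f]. *)
have : mu \o F @ \oo --> mu (\bigcup_n F n).
  apply: nondecreasing_cvg_mu => //; first exact: bigcup_measurable.
  move=> m n mn; rewrite subsetEset; apply: subset_itv0.
  by rewrite ler_weXn2l// ltW.
rewrite FU mu_f// E_nneg => /fine_cvgP[_] /= /cvgrPdist_lt muF.
apply/cvgrPdist_lt => /= e e0.
(* The norm is valued in [R[i]], so the tolerance is a positive complex number and has to be brought
   back to [R]. *)
have /complex_realP[r re] : e \is Num.real by rewrite realE ltW.
rewrite re in e0 *.
have r0 : 0 < r by rewrite -ltcR.
have := muF (r ^+ 2); rewrite exprn_gt0// => /(_ isT); apply: filterS => n.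
rewrite /= (mu_f _ (mF n))/= -(hnormBE f (mF n)) ger0_norm ?sqr_ge0// => fr.
rewrite normE ltcR -(@ltr_pXn2r _ 2)// nnegrE ?hnorm_ge0// ltW//.
Qed.

(** Band 0 keeps all of [0, 1], including a possible atom at 0, so that the partial sums telescope
    to the projections. *)
Definition band a f (k : nat) : H :=
  if k is j.+1 then P (a ^+ k) f - P (a ^+ j) f else P 1 f.

Lemma band_proj a f k : 1 < a -> P (a ^+ k) (band a f k) = band a f k.
Proof.
move=> a1; case: k => [|k]; first by rewrite expr0 /= EI// setIid.
have sub : [set` `[0, a ^+ k]] `<=` [set` `[0, a ^+ k.+1]].
  by apply: subset_itv0; rewrite ler_weXn2l// ltW.
by rewrite /= EB// !EI// setIid (setIidr sub).
Qed.

Lemma series_band a f n : series (band a f) n.+1 = P (a ^+ n) f.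
Proof.
rewrite /series /=; elim: n => [|n IH].
  by rewrite big_nat1 /= expr0.
by rewrite big_nat_recr//= IH /= addrC subrK.
Qed.

Lemma cvg_series_band a f : 1 < a -> series (band a f) @ \oo --> f.
Proof.
move=> a1; rewrite -(cvg_shiftS (series (band a f))) /=.
by under eq_cvg do rewrite series_band; exact: cvg_proj.
Qed.

End SpectralMeasure.

(** * Estimates of the K-functional from above and below *)

Section KFunctional.
Context {R : realType} {H : completeNormedModType R[i]}
  (form : {dot H for Num.conj}) (D : unbounded_op H) (E : set R -> H -> H).
Hypotheses (form_norm : induces_norm form) (D_sa : self_adjoint form D)
  (E_D : spectral_measure_of form D E).
Variable r : nat.
Implicit Types (f g : H) (s t w : R).

Local Notation P w := (E [set` `[0, w]]).
Local Notation K := (K_functional D r).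

Lemma le_K c f t : (forall f0 f1, f = f0 + f1 -> pow_dom D r f1 ->
  c <= hnorm f0 + t * (hnorm f1 + hnorm (iter r D f1))) -> c <= K f t.
Proof.
move=> h; apply: lb_le_inf.
  (* The infimum needs a nonempty set; the decomposition f = f + 0 is always available. *)
  exists (hnorm f + t * (hnorm (0 : H) + hnorm (iter r D 0))).
  by exists f, 0; rewrite addr0; split => //; have [] := pow_dom0 D r.
by move=> _ [f0 [f1 [ff fd ->]]]; exact: h.
Qed.

Lemma K_le f0 f1 t : 0 <= t -> pow_dom D r f1 ->
  K (f0 + f1) t <= hnorm f0 + t * (hnorm f1 + hnorm (iter r D f1)).
Proof.
move=> t0 f1d; apply: ge_inf; last by exists f0, f1.
by exists 0 => _ [g0 [g1 [_ _ ->]]]; rewrite addr_ge0 ?mulr_ge0 ?addr_ge0 ?hnorm_ge0.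
Qed.

Lemma K_ge0 f t : 0 <= t -> 0 <= K f t.
Proof.
by move=> t0; apply: le_K => *; rewrite addr_ge0 ?mulr_ge0 ?addr_ge0 ?hnorm_ge0.
Qed.

Lemma K_le_hnorm f t : 0 <= t -> K f t <= hnorm f.
Proof.
have [d0 i0] := pow_dom0 D r => t0.
by have := K_le f t0 d0; rewrite i0 addr0 hnorm0 addr0 mulr0 addr0.
Qed.

Lemma K_le_dom f t : 0 <= t -> pow_dom D r f ->
  K f t <= t * (hnorm f + hnorm (iter r D f)).
Proof. by move=> t0 fd; have := K_le 0 t0 fd; rewrite add0r hnorm0 add0r. Qed.

Lemma K_mono f s t : 0 <= s -> s <= t -> K f s <= K f t.
Proof.
move=> s0 st; apply: le_K => f0 f1 -> f1d; apply: le_trans (K_le _ s0 f1d) _.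
by rewrite lerD2l ler_wpM2r ?addr_ge0 ?hnorm_ge0.
Qed.

Lemma measurable_K f : measurable_fun ([set` `]0, +oo[] : set R) (K f).
Proof.
(* Monotonicity is known only for nonnegative arguments; clamping at 0 gives a function monotone on
   the whole line. *)
apply: (eq_measurable_fun (fun t => K f (Num.max t 0))) => [t|].
  by rewrite inE /= in_itv/= andbT => /ltW t0; rewrite (max_idPl t0).
apply: nondecreasing_measurable => // s t st; apply: K_mono.
  by rewrite le_max lexx orbT.
by rewrite ge_max !le_max st lexx orbT.
Qed.

Lemma ler_KD f g t : 0 <= t -> K (f + g) t <= K f t + K g t.
Proof.
move=> t0; rewrite -lerBlDr; apply: le_K => f0 f1 -> f1d.
rewrite lerBlDl -lerBlDr; apply: le_K => g0 g1 -> g1d; rewrite lerBlDl.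
rewrite addrACA; apply: le_trans (K_le _ t0 (pow_domD f1d g1d)) _.
rewrite iter_opD//.
have := ler_hnormD f0 g0; have := ler_hnormD f1 g1.
have := ler_hnormD (iter r D f1) (iter r D g1).
move: (hnorm (f0 + g0)) (hnorm (f1 + g1)) (hnorm (iter r D f1 + _)) => x y z.
nra.
Qed.

Lemma ler_K_sum (u : nat -> H) n t : 0 <= t ->
  K (\sum_(0 <= k < n) u k) t <= \sum_(0 <= k < n) K (u k) t.
Proof.
move=> t0; elim: n => [|n IH]; first by rewrite !big_nil -(@hnorm0 R H) K_le_hnorm.
by rewrite !big_nat_recr//=; apply: le_trans (ler_KD _ _ t0) _; rewrite lerD2r.
Qed.

(** The decompositions g + 0 and 0 + g give the two entries of the minimum. The factor 2 appears
    because both terms of the graph norm are at most w^r |g| when w >= 1. *)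
Lemma K_le_bandlimited w g t : 1 <= w -> P w g = g -> 0 <= t ->
  K g t <= 2 * Num.min 1 (t * w ^+ r) * hnorm g.
Proof.
move=> w1 gw t0; have w0 : 0 <= w := le_trans ler01 w1.
have := K_le_hnorm g t0; have := hnorm_ge0 g.
have := K_le_dom t0 (pow_dom_bounded E_D gw).
have := bernstein form_norm D_sa E_D r w0 gw.
have : 1 <= w ^+ r by rewrite exprn_ege1.
move: (w ^+ r) (hnorm (iter r D g)) (hnorm g) (K g t) => W x y z.
move=> W1 xWy zt y0 zy; case: (leP 1 (t * W)) => _; first by lra.
have : t * x <= t * (W * y) by rewrite ler_wpM2l.
have : t * y <= t * (W * y) by rewrite ler_wpM2l// ler_peMl.
lra.
Qed.

Lemma band_le_K a f k t : 1 < a -> (a ^+ r) ^- k <= t ->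
  hnorm (band E a f k) <= a ^+ r * K f t.
Proof.
move=> a1 kt; have a0 : 0 < a by exact: lt_trans a1.
have A1 : 1 <= a ^+ r by rewrite exprn_ege1// ltW.
have A0 : 0 < a ^+ r := lt_le_trans ltr01 A1.
have t0 : 0 <= t by apply: le_trans kt; rewrite invr_ge0 exprn_ge0// ltW.
rewrite -ler_pdivrMl//; apply: le_K => f0 f1 -> f1d; rewrite ler_pdivrMl//.
have mP w : measurable [set` `[0, w]] by exact: (measurable_itv `[0, w]).
have -> : band E a (f0 + f1) k = band E a f0 k + band E a f1 k.
  by case: k {kt} => [|k] /=; rewrite !(ED E_D)// opprD addrACA.
apply: le_trans (ler_hnormD _ _) _; rewrite mulrDr lerD//.
  apply: (@le_trans _ _ (hnorm f0)); last by rewrite ler_peMl ?hnorm_ge0.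
  case: k {kt} => [|k] /=; first exact: (hnormE_le form_norm E_D).
  have sub : [set` `[0, a ^+ k]] `<=` [set` `[0, a ^+ k.+1]].
    by apply: subset_itv0; rewrite ler_weXn2l// ltW.
  (* In this form the band of [f0] is obtained by two contractions. *)
  have -> : P (a ^+ k.+1) f0 - P (a ^+ k) f0 =
            P (a ^+ k.+1) (f0 - P (a ^+ k) f0).
    by rewrite (EB E_D)// (EI E_D)// (setIidr sub).
  apply: le_trans (hnormE_le form_norm E_D _ (mP _)) _.
  rewrite -(@ler_pXn2r _ 2)// ?nnegrE ?hnorm_ge0//.
  by rewrite (hnormBE form_norm E_D)// lerBlDr lerDl sqr_ge0.
case: k kt => [|k] kt /=.
  (* Band 0 has no positive lower frequency; here t >= 1, and the term |f1| of the graph norm takes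
     over. *)
  rewrite expr0 invr1 in kt; apply: le_trans (hnormE_le form_norm E_D _ (mP _)) _.
  have := hnorm_ge0 f1; have := hnorm_ge0 (iter r D f1).
  move: (hnorm f1) (hnorm (iter r D f1)) => x y; rewrite mulrA.
  by move=> ? ?; have : 1 <= a ^+ r * t; nra.
have ak : 0 <= a ^+ k by rewrite exprn_ge0// ltW.
have akS : a ^+ k <= a ^+ k.+1 by rewrite ler_weXn2l// ltW.
have := reverse_bernstein form_norm D_sa E_D ak akS f1d.
rewrite -exprM mulnC exprM -ler_pdivlMl ?exprn_gt0// => /le_trans; apply.
(* Band k+1 starts at frequency a^k while [kt] concerns A^-(k+1), with A = a^r: this shift by one
   costs the factor A. *)
have Ak : (a ^+ r) ^- k <= a ^+ r * t.
  by rewrite -ler_pdivrMl//; apply: le_trans kt; rewrite exprS invfM.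
rewrite mulrA; apply: le_trans (_ : a ^+ r * t * hnorm (iter r D f1) <= _).
  by rewrite ler_wpM2r// hnorm_ge0.
by rewrite ler_wpM2l ?lerDr ?hnorm_ge0// mulr_ge0// ltW.
Qed.

End KFunctional.

(** * A summable and integrable kernel on the multiplicative half-line *)

Section Kernel.
Context {R : realType}.
Implicit Types (u s t e l m : R).

(* Up to constants, [kern u] is [min u (1 / u)]; it is also the logarithmic
   derivative [u G'(u)] of the bounded increasing function [G u = u / (1 + u)],
   so that its sums along geometric progressions and its integrals against
   [dt / t] are controlled by the increments of [G]. *)
Definition kern u : R := u / (1 + u) ^+ 2.

Lemma kern_ge0 u : 0 <= u -> 0 <= kern u.
Proof. by move=> u0; rewrite divr_ge0// exprn_ge0// addr_ge0. Qed.

Lemma kern_le1 u : 0 <= u -> kern u <= 1.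
Proof.
move=> u0; rewrite ler_pdivrMr ?exprn_gt0 ?ltr_pwDl// mul1r; nra.
Qed.

(** The increment of G from u to l u is exactly (l - 1) u / ((1 + u) (1 + l u)), and 1 + l u <= l (1
    + u). *)
Lemma kern_increment l u : 1 < l -> 0 < u ->
  (l - 1) * kern u <= l * (l * u / (1 + l * u) - u / (1 + u)).
Proof.
move=> l1 u0; have l0 : 0 < l by exact: lt_trans l1.
have lu0 : 0 < 1 + l * u by rewrite ltr_pwDl// mulr_ge0// ltW.
have u1 : 0 < 1 + u by rewrite ltr_pwDl// ltW.
have -> : l * (l * u / (1 + l * u) - u / (1 + u)) =
    (l - 1) * kern u * (l * (1 + u) / (1 + l * u)).
  by rewrite /kern; field; rewrite ?(gt_eqF lu0) ?(gt_eqF u1).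
rewrite ler_peMr//; first by rewrite mulr_ge0 ?kern_ge0 ?subr_ge0// ltW.
by rewrite ler_pdivlMr// mul1r mulrDr mulr1 lerD2r ltW.
Qed.

(** The increments of G along the progression telescope, and G takes values in [0, 1]. *)
Lemma sum_kern l u n : 1 < l -> 0 < u ->
  \sum_(0 <= k < n) kern (l ^+ k * u) <= l / (l - 1).
Proof.
move=> l1 u0; have l0 : 0 < l by exact: lt_trans l1.
have l10 : 0 < l - 1 by rewrite subr_gt0.
pose G u := u / (1 + u).
have G0 v : 0 < v -> 0 <= G v.
  by move=> v0; rewrite divr_ge0 ?addr_ge0// ltW.
have G1 v : 0 < v -> G v <= 1.
  by move=> v0; rewrite ler_pdivrMr ?ltr_pwDl ?(ltW v0)// mul1r lerDr.
have ul k : 0 < l ^+ k * u by rewrite mulr_gt0// exprn_gt0.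
rewrite ler_pdivlMr// mulrC big_distrr/=.
apply: (@le_trans _ _ (\sum_(0 <= k < n) l * (G (l ^+ k.+1 * u) - G (l ^+ k * u)))).
  apply: ler_sum => k _; have := kern_increment l1 (ul k).
  by rewrite /G exprS -(mulrA l _ u).
rewrite -big_distrr/= telescope_sumr// (ler_piMr (ltW l0))//.
have := G1 _ (ul n); have := G0 _ (ul 0%N); lra.
Qed.

(** The left side decays like s^(1 - th) at 0 and s^(- th) at infinity. With u = s^e, where 2e is
    the smaller exponent, it is at most min(u, 1/u)^2, while min(u, 1/u) <= 4 kern u. The square
    leaves one kernel factor for summation and one for the terms. *)
Lemma min_le_kern th s : 0 < th < 1 -> 0 < s ->
  s `^ (- th) * Num.min 1 s <=
  16 * kern (s `^ (Num.min th (1 - th) / 2)) ^+ 2.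
Proof.
move=> /andP[th0 th1] s0; set e := Num.min th (1 - th) / 2.
have e0 : 0 < e by rewrite divr_gt0// lt_min th0 subr_gt0.
have eth : e + e <= th by rewrite -splitr ge_min lexx.
have eth1 : e + e <= 1 - th by rewrite -splitr ge_min lexx orbT.
set u := s `^ e; have u0 : 0 < u by rewrite powR_gt0.
have u1 : 0 < 1 + u by rewrite addr_gt0.
have kE : kern u * (1 + u) ^+ 2 = u by rewrite divfK// expf_neq0// gt_eqF.
have k0 := kern_ge0 (ltW u0).
have sD x y : s `^ (x + y) = s `^ x * s `^ y.
  by rewrite powRD// (gt_eqF s0) implybT.
case: (leP 1 s) => s1.
  have u_ge1 : 1 <= u by have := ler_powR s1 (ltW e0); rewrite powRr0.
  have : 1 <= 4 * (kern u * u) by nra.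
  have : s `^ (- th) * (u * u) <= 1.
    rewrite -!sD.
    by rewrite -[leRHS](powRr0 s) ler_powR//; lra.
  rewrite mulr1; move: (s `^ (- th)) (powR_ge0 s (- th)) => x x0 xu ku.
  have : 1 <= (4 * (kern u * u)) ^+ 2 by rewrite exprn_ege1.
  move=> h; have : x <= x * (4 * (kern u * u)) ^+ 2 by rewrite ler_peMr.
  have : x * (u * u) * (16 * kern u ^+ 2) <= 1 * (16 * kern u ^+ 2).
    by rewrite ler_wpM2r// mulr_ge0// sqr_ge0.
  lra.
have s01 : 0 < s <= 1 by rewrite s0 ltW.
have u_le1 : u <= 1 by have := ger_powR s01 (ltW e0); rewrite powRr0.
have -> : s `^ (- th) * s = s `^ (1 - th).
  by rewrite -{2}(powRr1 (ltW s0)) -sD addrC.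
apply: (@le_trans _ _ (u * u)).
  by rewrite -sD ger_powR.
have : u <= 4 * kern u by nra.
nra.
Qed.

Lemma continuous_kern_powR e m t : 0 < e -> 0 <= m -> 0 < t ->
  {for t, continuous (fun t => kern (m * t `^ e) / t)}.
Proof.
move=> e0 m0 t0; have mt : 0 < 1 + m * t `^ e by rewrite ltr_pwDl// mulr_ge0// powR_ge0.
have cp : {for t, continuous (fun t => m * t `^ e)}.
  apply: continuousM; first exact: cst_continuous.
  apply: differentiable_continuous; apply/derivable1_diffP.
  by have [] := is_derive1_powR e t0.
apply: continuousM; last by apply: continuousV; rewrite ?gt_eqF//; exact: cvg_id.
apply: continuousM => //.
apply: (@continuousV _ _ (fun t => (1 + m * t `^ e) ^+ 2)).
  by rewrite expf_neq0// gt_eqF.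
apply: (@continuous_comp _ _ _ (fun t => 1 + m * t `^ e) (fun x => x ^+ 2)).
  by apply: continuousD => //; exact: cst_continuous.
exact: exprn_continuous.
Qed.

(** Since G v = 1 - 1 / (1 + v), this antiderivative is (G (m t^e) - 1) / e. *)
Lemma is_derive_kern_powR e m t : 0 < e -> 0 <= m -> 0 < t ->
  is_derive t 1 (fun t => - (e^-1 * (1 + m * t `^ e)^-1)) (kern (m * t `^ e) / t).
Proof.
move=> e0 m0 t0; have mt : 0 < 1 + m * t `^ e by rewrite ltr_pwDl// mulr_ge0// powR_ge0.
have d1 := is_derive1_powR e t0.
have d2 := is_deriveD (is_derive_cst (1 : R) t 1) (is_deriveZ m d1).
have d3 := is_deriveN (is_deriveZ e^-1
  (@is_deriveV _ (fun t => 1 + m * t `^ e) _ _ _ (negbT (gt_eqF mt)) d2)).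
apply: (@is_derive_eq _ _ _ _ _ _ _ _ d3).
have tE : t `^ (e - 1) = t `^ e / t.
  by rewrite powRD ?(gt_eqF t0) ?implybT// powR_inv1// ltW.
rewrite /= /kern tE /GRing.scale /=; field.
by rewrite (gt_eqF mt) (gt_eqF t0) (gt_eqF e0).
Qed.

Lemma integral_kern e m : 0 < e -> 0 <= m ->
  (\int[lebesgue_measure]_(t in `]0%R, +oo[) (kern (m * t `^ e) / t)%:E
    <= (e^-1)%:E)%E.
Proof.
move=> e0 m0.
pose f t := kern (m * t `^ e) / t.
pose F t : R := - (e^-1 * (1 + m * t `^ e)^-1).
(* Compact intervals exhausting the half-line; the offset 2 keeps even the first one
   nondegenerate. *)
pose I n : set R := [set` `[n.+2%:R^-1, n.+2%:R]].
have I0 n t : I n t -> 0 < t.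
  by rewrite /I /= in_itv/= => /andP[+ _]; apply: lt_le_trans; rewrite invr_gt0.
have f0 t : 0 < t -> 0 <= f t.
  by move=> t0; rewrite divr_ge0 ?kern_ge0 ?mulr_ge0 ?powR_ge0// ltW.
have IU : \bigcup_n I n = [set` `]0, +oo[].
  apply/seteqP; split => t; first by move=> [n _ /I0 t0]; rewrite /= in_itv/= t0.
  rewrite /= in_itv/= andbT => t0.
  have tV : 0 < t^-1 by rewrite invr_gt0.
  pose n := maxn (Num.truncn t) (Num.truncn t^-1).
  exists n => //; rewrite /I /= in_itv/=; apply/andP; split.
    rewrite -[leRHS]invrK lef_pV2 ?posrE// ltW//.
    apply: lt_le_trans (truncnS_gt _) _; rewrite ler_nat ltnS.
    by rewrite (leq_trans (leq_maxr (Num.truncn t) _)).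
  rewrite ltW//; apply: lt_le_trans (truncnS_gt _) _; rewrite ler_nat ltnS.
  by rewrite (leq_trans (leq_maxl _ (Num.truncn t^-1))).
have mf : measurable_fun ([set` `]0, +oo[] : set R) (EFin \o f).
  apply/measurable_EFinP; apply: open_continuous_measurable_fun => // t.
  rewrite inE /= in_itv/= andbT => t0; exact: continuous_kern_powR.
have FTC n : (\int[lebesgue_measure]_(t in I n) (f t)%:E <= (e^-1)%:E)%E.
  have n1 : n.+2%:R^-1 < n.+2%:R :> R.
    by apply: (@lt_trans _ _ 1); rewrite ?invf_lt1 ?ltr1n.
  have n0 : 0 < n.+2%:R^-1 :> R by rewrite invr_gt0.
  have Fd t : 0 < t -> is_derive t 1 F (f t) by exact: is_derive_kern_powR.
  have Fc t : 0 < t -> {for t, continuous F}.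
    move=> t0; apply: differentiable_continuous; apply/derivable1_diffP.
    by have [] := Fd _ t0.
  rewrite (@continuous_FTC2 _ f F)//.
  - rewrite -EFinB lee_fin /F opprK.
    have : e^-1 * (1 + m * n.+2%:R^-1 `^ e)^-1 <= e^-1.
      rewrite ler_piMr ?invr_ge0 ?(ltW e0)// invf_le1;
        by rewrite ?ltr_pwDl ?lerDl ?mulr_ge0 ?powR_ge0.
    have : 0 <= e^-1 * (1 + m * n.+2%:R `^ e)^-1.
      by rewrite mulr_ge0 ?invr_ge0 ?addr_ge0 ?mulr_ge0 ?powR_ge0// ltW.
    lra.
  - apply: continuous_in_subspaceT => t; rewrite inE => /I0 t0.
    exact: continuous_kern_powR.
  - split.
    + by move=> t; rewrite in_itv/= => /andP[nt _]; have [] := Fd _ (lt_trans n0 nt).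
    + by apply: cvg_at_right_filter; exact: Fc.
    + by apply: cvg_at_left_filter; apply: Fc; exact: lt_trans n1.
  - move=> t; rewrite in_itv/= => /andP[nt _].
    by rewrite derive1E; have /(_ (lt_trans n0 nt)) [_ ->] := Fd t.
rewrite -IU.
have IT n t : I n t -> [set` `]0, +oo[] t by move=> /I0 t0; rewrite /= in_itv/= t0.
have : (\int[lebesgue_measure]_(t in I n) (f t)%:E @[n --> \oo]
    --> \int[lebesgue_measure]_(t in \bigcup_n I n) (f t)%:E)%E.
  apply: ge0_nondecreasing_set_cvg_integral.
  - move=> i j ij; rewrite subsetEset => t; rewrite /I /= !in_itv/= => /andP[it tj].
    apply/andP; split; [apply: le_trans it|apply: le_trans tj _].
      by rewrite lef_pV2 ?posrE// ler_nat.
    by rewrite ler_nat.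
  - by move=> i; exact: (measurable_itv `[_, _]).
  - by move=> i; apply: measurable_funS mf => // t; exact: IT.
  - by move=> i t /I0 t0; rewrite lee_fin f0.
move=> cI; rewrite -(cvg_lim _ cI)//; apply: lime_le; first exact: cvgP cI.
exact: nearW.
Qed.

End Kernel.

(** * Comparison of the Besov norm with the weighted sequence norm *)

Section BesovNorm.
Context {R : realType} {H : completeNormedModType R[i]}
  (form : {dot H for Num.conj}) (D : unbounded_op H) (E : set R -> H -> H).
Hypotheses (form_norm : induces_norm form) (D_sa : self_adjoint form D)
  (E_D : spectral_measure_of form D E).
Variables (alpha a : R) (r : nat).
Hypotheses (alpha_gt0 : 0 < alpha) (a_gt1 : 1 < a) (alpha_ltr : alpha < r%:R).
Implicit Types (f : H) (u : nat -> H) (t q : R).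

Local Notation P w := (E [set` `[0, w]]).
Local Notation K := (K_functional D r).
Let th := alpha / r%:R.
Let A := a ^+ r.
Let e := Num.min th (1 - th) / 2.
(** Ratio of the geometric progression (t A^k)^e in k. *)
Let l := A `^ e.
(** Here 32 = 2 * 16 combines [K_le_bandlimited] and [min_le_kern]; the other factor bounds the
    kernel sums by [sum_kern]. *)
Let C := 32 * (l / (l - 1)).
Let g f t := t `^ (- th) * K f t.
Let b u k := a `^ (k%:R * alpha) * hnorm (u k).
Let kern_ t k := kern (l ^+ k * t `^ e).

Let a0 : 0 < a. Proof. exact: lt_trans a_gt1. Qed.
Let r0 : 0 < r%:R :> R. Proof. exact: lt_trans alpha_ltr. Qed.
Let th01 : 0 < th < 1.
Proof. by rewrite divr_gt0//= ltr_pdivrMr// mul1r. Qed.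
Let A1 : 1 < A.
Proof. by rewrite exprn_egt1// -lt0n -(ltr_nat R). Qed.
Let A0 : 0 < A. Proof. exact: lt_trans A1. Qed.
Let e0 : 0 < e.
Proof. by have /andP[th0 th1] := th01; rewrite divr_gt0// lt_min th0 subr_gt0. Qed.
Let l1 : 1 < l.
Proof.
have := gt0_ltr_powR e0 (ler01 : 1 \in Num.nneg) (ltW A0 : A \in Num.nneg) A1.
by rewrite powR1.
Qed.
Let l0 : 0 < l. Proof. exact: lt_trans l1. Qed.
Let C0 : 0 < C.
Proof. by rewrite mulr_gt0// divr_gt0// subr_gt0. Qed.
Let b0 u k : 0 <= b u k. Proof. by rewrite mulr_ge0 ?powR_ge0 ?hnorm_ge0. Qed.
Let kern0 t k : 0 <= kern_ t k.
Proof. by rewrite kern_ge0// mulr_ge0 ?powR_ge0// exprn_ge0// ltW. Qed.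
Let g0 f t : 0 < t -> 0 <= g f t.
Proof. by move=> t0; rewrite mulr_ge0 ?powR_ge0 ?K_ge0// ltW. Qed.

Lemma weight_powR k : a `^ (k%:R * alpha) = (A ^+ k) `^ th.
Proof.
rewrite /A -exprM -powR_mulrn ?(ltW a0)// -powRrM natrM; congr powR.
by rewrite /th; field; rewrite gt_eqF.
Qed.

Let kern_scaleE t k : 0 < t -> (t * A ^+ k) `^ e = l ^+ k * t `^ e.
Proof.
move=> t0; have Ak : 0 <= A ^+ k by rewrite exprn_ge0// ltW.
rewrite (powRM _ (ltW t0) Ak) mulrC; congr (_ * _).
by rewrite -(powR_mulrn _ (ltW A0)) -(powR_mulrn _ (ltW l0)) /l -!powRrM mulrC.
Qed.

Lemma K_term_le u k t : P (a ^+ k) (u k) = u k -> 0 < t ->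
  t `^ (- th) * K (u k) t <= 32 * kern_ t k ^+ 2 * b u k.
Proof.
move=> uk t0; have Ak : 0 <= A ^+ k by rewrite exprn_ge0// ltW.
have s0 : 0 < t * A ^+ k by rewrite mulr_gt0// exprn_gt0.
have ak1 : 1 <= a ^+ k by rewrite exprn_ege1// ltW.
have := K_le_bandlimited form_norm D_sa E_D r ak1 uk (ltW t0).
rewrite exprAC -/A => /(ler_wpM2l (powR_ge0 t (- th)))/le_trans; apply.
(* Splitting off the weight of b_k leaves a function of t A^k alone. *)
have -> : t `^ (- th) = a `^ (k%:R * alpha) * (t * A ^+ k) `^ (- th).
  rewrite weight_powR (powRM _ (ltW t0) Ak) mulrCA -powRD.
    by rewrite subrr powRr0 mulr1.
  by rewrite expf_eq0 (gt_eqF A0) andbF implybT.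
have := min_le_kern th01 s0; rewrite kern_scaleE// -/(kern_ t k).
rewrite /b; move: (hnorm_ge0 (u k)) (powR_ge0 a (k%:R * alpha)).
move: (hnorm (u k)) (a `^ _) ((t * A ^+ k) `^ (- th)) (Num.min 1 _) => x y z m.
move=> x0 y0 h; have := ler_wpM2l (mulr_ge0 x0 y0) h; lra.
Qed.

(** Subadditivity is applied to a finite partial sum, the remainder being absorbed by K <= |.| and
    an arbitrary slack [d]. One kernel factor is bounded through [M], the other is summed. *)
Lemma K_le_sup u f t M : (forall k, P (a ^+ k) (u k) = u k) ->
  series u @ \oo --> f -> 0 < t -> (forall k, kern_ t k * b u k <= M) ->
  g f t <= C * M.
Proof.
move=> uP uf t0 uM; apply/ler_addgt0Pl => /= d d0.
have tth : 0 < t `^ (- th) by rewrite powR_gt0.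
have d1 : 0 < d / t `^ (- th) by rewrite divr_gt0.
have /cvgrPdist_lt/(_ (d / t `^ (- th))%:C) := uf.
rewrite ltcR => /(_ d1)[n _ /(_ n (leqnn n))]/=.
rewrite normE ltcR ltr_pdivlMr// mulrC => fn.
have M0 : 0 <= M by apply: le_trans (uM 0%N); rewrite mulr_ge0.
rewrite /g -(subrK (series u n) f).
apply: le_trans (_ : t `^ (- th) * (hnorm (f - series u n) +
   \sum_(0 <= k < n) K (u k) t) <= _).
  rewrite ler_pM2l//; apply: le_trans (ler_KD _ _ _ _ (ltW t0)) _.
  by rewrite lerD ?K_le_hnorm ?ler_K_sum// ltW.
rewrite mulrDr lerD ?(ltW fn)// big_distrr /=.
apply: (@le_trans _ _ (\sum_(0 <= k < n) 32 * M * kern_ t k)).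
  apply: ler_sum => k _; apply: le_trans (K_term_le (uP k) t0) _.
  have := ler_wpM2l (kern0 t k) (uM k); lra.
rewrite -big_distrr/= /C.
have := sum_kern n l1 (powR_gt0 e t0).
move=> /(ler_wpM2l M0); rewrite /kern_; lra.
Qed.

Let ge0_le_poweR (x : \bar R) p : 0 <= p -> (0 <= x)%E ->
  forall y, (x <= y)%E -> (x `^ p <= y `^ p)%E.
Proof.
move=> p0 x0 y xy; apply: gt0_ler_poweR => //; rewrite in_itv/= ?x0 ?leey//.
by rewrite (le_trans x0 xy).
Qed.

Lemma measurable_besov_integrand f q : measurable_fun
  ([set` `]0, +oo[] : set R) (fun t => ((g f t) `^ q / t)%:E).
Proof.
apply/measurable_EFinP; apply: measurable_funM; last first.
  apply: open_continuous_measurable_fun => // t.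
  by rewrite inE /= in_itv/= andbT => t0; apply: inv_continuous; rewrite gt_eqF.
apply: (measurableT_comp (measurable_powR q)).
apply: measurable_funM; last exact: measurable_K.
by apply: measurable_funTS; exact: measurable_powR.
Qed.

Lemma integral_le_series u f q : 1 <= q -> (forall k, P (a ^+ k) (u k) = u k) ->
  series u @ \oo --> f ->
  (\int[lebesgue_measure]_(t in `]0%R, +oo[) (g f t `^ q / t)%:E <=
   (C `^ q * e^-1)%:E * \sum_(0 <= k <oo) (b u k `^ q)%:E)%E.
Proof.
move=> q1 uP uf; have q0 : 0 < q := lt_le_trans ltr01 q1.
pose h k t := (kern_ t k / t * b u k `^ q)%:E.
have h0 k t : 0 < t -> (0 <= h k t)%E.
  by move=> t0; rewrite lee_fin mulr_ge0 ?powR_ge0// divr_ge0// ltW.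
have pos t : [set` `]0, +oo[] t -> 0 < t by rewrite /= in_itv/= andbT.
have mk k : measurable_fun ([set` `]0, +oo[] : set R) (fun t => (kern_ t k / t)%:E).
  apply/measurable_EFinP; apply: open_continuous_measurable_fun => // t.
  rewrite inE => /pos t0; rewrite /kern_.
  exact: continuous_kern_powR e0 (exprn_ge0 k (ltW l0)) t0.
have mh k : measurable_fun ([set` `]0, +oo[] : set R) (h k).
  apply/measurable_EFinP; apply: measurable_funM => //.
  by have /measurable_EFinP := mk k.
have key t : 0 < t ->
    ((g f t `^ q / t)%:E <= (C `^ q)%:E * \sum_(0 <= k <oo) h k t)%E.
  move=> t0; have S0 : (0 <= \sum_(0 <= k <oo) h k t)%E.
    by apply: nneseries_ge0 => k _ _; exact: h0.
  have hS k : (h k t <= \sum_(0 <= k <oo) h k t)%E.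
    apply: le_trans (nneseries_lim_ge k.+1 _); last by move=> n _ _; exact: h0.
    rewrite big_nat_recr//= leeDr//; apply: sume_ge0 => n _; exact: h0.
  move: S0 hS; case: (\sum_(0 <= k <oo) h k t)%E => [s| |] //; last first.
    by move=> _ _; rewrite gt0_muley ?leey// lte_fin powR_gt0.
  rewrite lee_fin => s0 hS; rewrite -EFinM lee_fin ler_pdivrMr//.
  have st : 0 <= s * t by rewrite mulr_ge0// ltW.
  (* As kern <= 1 and q >= 1, (kern b_k)^q <= kern b_k^q, a single term of the series s t; so M = (s
     t)^(1/q) is admissible. *)
  have gle : g f t <= C * (s * t) `^ q^-1.
    apply: (K_le_sup uP uf t0) => k.
    have kb0 : 0 <= kern_ t k * b u k by rewrite mulr_ge0.
    rewrite -[leLHS](powRr1 kb0) -(mulfV (lt0r_neq0 q0)) powRrM.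
    apply: ge0_ler_powR; rewrite ?nnegrE ?powR_ge0 ?invr_ge0 ?(ltW q0)//.
    have := hS k; rewrite lee_fin mulrAC ler_pdivrMr//; apply: le_trans.
    rewrite powRM// ler_wpM2r ?powR_ge0//.
    have u0 : 0 < l ^+ k * t `^ e by rewrite mulr_gt0 ?powR_gt0 ?exprn_gt0.
    by rewrite ge1r_powR// kern_le1 ?(ltW u0)// andbT divr_gt0// exprn_gt0// addr_gt0.
  apply: le_trans (ge0_ler_powR (ltW q0) _ _ gle) _.
  - by rewrite nnegrE g0.
  - by rewrite nnegrE mulr_ge0 ?powR_ge0// ltW.
  by rewrite powRM ?(ltW C0) ?powR_ge0// -powRrM mulVf ?lt0r_neq0// powRr1// mulrA.
have mS : measurable_fun ([set` `]0, +oo[] : set R)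
    (fun t => \sum_(0 <= k <oo) h k t)%E.
  apply: (@ge0_emeasurable_sum _ _ _ _ h xpredT) => [k t /pos t0 _|k _].
    exact: h0.
  exact: mh.
apply: (@le_trans _ _ (\int[lebesgue_measure]_(t in `]0%R, +oo[)
    ((C `^ q)%:E * \sum_(0 <= k <oo) h k t))%E).
  apply: ge0_le_integral => //.
  - by move=> t /pos t0; rewrite lee_fin divr_ge0 ?powR_ge0// ltW.
  - exact: measurable_besov_integrand.
  - exact: measurable_funeM.
  - by move=> t /pos; exact: key.
rewrite ge0_integralZl_EFin ?powR_ge0//; last first.
  by move=> t /pos t0; apply: nneseries_ge0 => k _ _; exact: h0.
rewrite EFinM -muleA lee_pmul2l ?lte_fin ?powR_gt0//.
(* Sum and integral are exchanged by nonnegativity; each kernel integral is then at most 1/e,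
   uniformly in k. *)
rewrite integral_nneseries//; last by move=> k t /pos; exact: h0.
rewrite -nneseriesZl; last by move=> k _; rewrite lee_fin powR_ge0.
apply: lee_nneseries => [k _ _|k _].
  by apply: integral_ge0 => t /pos; exact: h0.
rewrite /h; under eq_integral do rewrite mulrC EFinM.
rewrite ge0_integralZl_EFin ?powR_ge0//; last 2 first.
- by move=> t /pos t0; rewrite lee_fin divr_ge0// ltW.
- exact: mk.
rewrite muleC lee_wpmul2r ?lee_fin ?powR_ge0//.
by apply: integral_kern => //; rewrite exprn_ge0// ltW.
Qed.

Lemma weighted_seq_normE u q :
  weighted_seq_norm a alpha q%:E u =
  ((\sum_(0 <= k <oo) (b u k `^ q)%:E) `^ q^-1)%E.
Proof. by []. Qed.

Lemma besov_le_weighted u f q : 1 <= q -> (forall k, P (a ^+ k) (u k) = u k) ->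
  series u @ \oo --> f ->
  (besov_norm D alpha q%:E r f <=
   (C * e^-1 `^ q^-1)%:E * weighted_seq_norm a alpha q%:E u)%E.
Proof.
move=> q1 uP uf; have q0 : 0 < q := lt_le_trans ltr01 q1.
rewrite /besov_norm /weighted_seq_norm.
apply: le_trans (ge0_le_poweR _ _ (integral_le_series q1 uP uf)) _.
- by rewrite invr_ge0 ltW.
- apply: integral_ge0 => t; rewrite /= in_itv/= andbT => t0.
  by rewrite lee_fin divr_ge0 ?powR_ge0// ltW.
rewrite poweRM//; last 2 first.
- by rewrite lee_fin mulr_ge0 ?powR_ge0// invr_ge0 ltW.
- by apply: nneseries_ge0 => k _ _; rewrite lee_fin powR_ge0.
rewrite poweR_EFin powRM ?powR_ge0 ?invr_ge0 ?(ltW e0)// -powRrM mulfV ?lt0r_neq0//.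
by rewrite powRr1// ltW.
Qed.

Lemma besov_le_weighted_sup u f : (forall k, P (a ^+ k) (u k) = u k) ->
  series u @ \oo --> f ->
  (besov_norm D alpha +oo r f <= C%:E * weighted_seq_norm a alpha +oo u)%E.
Proof.
move=> uP uf; apply: ub_ereal_sup => _ [t ht <-].
have t0 : 0 < t by move: ht; rewrite /= in_itv/= andbT.
have bS k : ((b u k)%:E <= weighted_seq_norm a alpha +oo u)%E.
  by apply: ereal_sup_ubound; exists k.
case: (weighted_seq_norm _ _ _ _) bS => [s| |] bS; last 2 first.
- by rewrite gt0_muley ?leey// lte_fin.
- by have := bS 0%N.
rewrite -EFinM lee_fin; apply: (K_le_sup uP uf t0) => k.
have := bS k; rewrite lee_fin; apply: le_trans.
by rewrite ler_piMl// kern_le1// mulr_ge0 ?powR_ge0// exprn_ge0// ltW.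
Qed.

(** * Bounding the spectral bands by the Besov norm on geometric intervals *)

Let J k : set R := [set` `](A ^- k), (A * A ^- k)[].

Let J_gt0 k t : J k t -> 0 < t.
Proof.
rewrite /J /= in_itv/= => /andP[+ _]; apply: le_lt_trans.
by rewrite invr_ge0 exprn_ge0// ltW.
Qed.

(** The lower bound on t feeds [band_le_K]; the upper bound A^k t <= A turns the weight (A^k)^th
    into at most a^alpha t^(- th). *)
Lemma band_le_g f k t : A ^- k <= t -> t <= A * A ^- k ->
  b (band E a f) k <= a `^ alpha * A * g f t.
Proof.
move=> kt tk; have t0 : 0 < t by apply: lt_le_trans kt; rewrite invr_gt0 exprn_gt0.
have Ak : 0 < A ^+ k by rewrite exprn_gt0.
have ineq : a `^ (k%:R * alpha) <= a `^ alpha * t `^ (- th).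
  have -> : a `^ alpha = A `^ th.
    by have := weight_powR 1; rewrite mul1r expr1.
  rewrite weight_powR powRN ler_pdivlMr ?powR_gt0// -(powRM _ (ltW Ak) (ltW t0)).
  apply: ge0_ler_powR; rewrite ?nnegrE ?mulr_ge0 ?(ltW t0) ?(ltW Ak) ?(ltW A0)//.
    exact: ltW.
  by rewrite mulrC -ler_pdivlMr.
have := band_le_K form_norm D_sa E_D f a_gt1 kt; rewrite -/A => h.
apply: le_trans (ler_pM (powR_ge0 _ _) (hnorm_ge0 _) ineq h) _.
by rewrite /g mulrACA.
Qed.

Let trivIset_J : trivIset setT J.
Proof.
apply/trivIsetP => i j _ _; wlog ij : i j / (i < j)%N.
  move=> W; rewrite neq_ltn => /orP[] ij; first by apply: W; rewrite ?ltn_eqF.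
  by rewrite setIC; apply: W; rewrite ?ltn_eqF.
move=> _; apply/seteqP; split => t //=; rewrite /J /= !in_itv/=.
move=> [/andP[it _] /andP[_ tj]]; have := lt_trans it tj.
rewrite ltNge => /negP; apply.
rewrite -(subnKC ij) addSn exprS invfM mulrA divff ?gt_eqF// mul1r.
by rewrite lef_pV2 ?posrE ?exprn_gt0// ler_weXn2l ?leq_addr// ltW.
Qed.

Let measurable_divJ k c : measurable_fun (J k) (fun t => (c / t)%:E).
Proof.
apply/measurable_EFinP; apply: measurable_funM => //.
apply: open_continuous_measurable_fun; first exact: interval_open.
by move=> t; rewrite inE => /J_gt0 t0; apply: inv_continuous; rewrite gt_eqF.
Qed.

(** Replacing 1/t by its value at the right endpoint gives the ratio of length to endpoint, 1 -
    1/A. *)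
Let integral_J k c : 0 <= c ->
  (((1 - A^-1) * c)%:E <= \int[lebesgue_measure]_(t in J k) (c / t)%:E)%E.
Proof.
move=> c0; have Ak : 0 < A ^- k by rewrite invr_gt0 exprn_gt0.
have lt : A ^- k < A * A ^- k by rewrite ltr_pMl.
have mJ : measurable (J k) by exact: (measurable_itv `]_, _[).
apply: (@le_trans _ _
   (\int[lebesgue_measure]_(t in J k) (c / (A * A ^- k))%:E)%E).
  have mE : lebesgue_measure (J k : set R) = (A * A ^- k - A ^- k)%:E.
    by rewrite lebesgue_measure_itv/= lte_fin lt.
  rewrite integral_cst// [X in (_ <= _ * X)%E]mE -EFinM lee_fin.
  rewrite le_eqVlt; apply/orP; left; apply/eqP; field.
  by rewrite !gt_eqF// exprn_gt0.
apply: ge0_le_integral => //.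
- by move=> t _; rewrite lee_fin divr_ge0// mulr_ge0// ltW.
- exact: measurable_divJ.
- move=> t Jt; have t0 := J_gt0 Jt; rewrite lee_fin ler_wpM2l// lef_pV2 ?posrE//.
    by move: Jt; rewrite /J /= in_itv/= => /andP[_ /ltW].
  by rewrite mulr_gt0.
Qed.

Lemma series_le_integral f q : 0 < q ->
  ((1 - A^-1)%:E * \sum_(0 <= k <oo) (b (band E a f) k `^ q)%:E <=
   ((a `^ alpha * A) `^ q)%:E *
   \int[lebesgue_measure]_(t in `]0%R, +oo[) (g f t `^ q / t)%:E)%E.
Proof.
move=> q0; set c := a `^ alpha * A.
have c0 : 0 <= c by rewrite mulr_ge0 ?powR_ge0// ltW.
have gf t : 0 < t -> 0 <= g f t `^ q / t by move=> t0; rewrite divr_ge0 ?powR_ge0// ltW.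
have mJ k : measurable (J k) by exact: (measurable_itv `]_, _[).
have sub : \bigcup_k J k `<=` [set` `]0, +oo[].
  by move=> t [k _ /J_gt0 t0]; rewrite /= in_itv/= t0.
have mg := measurable_besov_integrand f q.
have mgJ (B : set R) : B `<=` \bigcup_k J k -> measurable B ->
    measurable_fun B (fun t => (g f t `^ q / t)%:E).
  by move=> BJ mB; apply: measurable_funS mg => //; apply: subset_trans sub.
apply: (@le_trans _ _ ((c `^ q)%:E *
    \int[lebesgue_measure]_(t in \bigcup_k J k) (g f t `^ q / t)%:E))%E; last first.
  rewrite lee_wpmul2l ?lee_fin ?powR_ge0//; apply: ge0_subset_integral => //.
  - apply: bigcup_measurable => k _; exact: mJ.
  - by move=> t; rewrite /= in_itv/= andbT => t0; rewrite lee_fin gf.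
rewrite ge0_integral_bigcup//; last 2 first.
- by apply: mgJ => //; apply: bigcup_measurable => k _; exact: mJ.
- by move=> t [k _ /J_gt0 t0]; rewrite lee_fin gf.
rewrite -!nneseriesZl; last 2 first.
- by move=> k _; apply: integral_ge0 => t /J_gt0 t0; rewrite lee_fin gf.
- by move=> k _; rewrite lee_fin powR_ge0.
apply: lee_nneseries => k _.
  move=> _; rewrite -EFinM lee_fin mulr_ge0 ?powR_ge0// subr_ge0 invf_le1//.
  exact: ltW.
rewrite -ge0_integralZl_EFin ?powR_ge0//; last 3 first.
- exact: mJ.
- by move=> t /J_gt0 t0; rewrite lee_fin gf.
- apply: mgJ => // t Jt; by exists k.
rewrite -EFinM; apply: le_trans (integral_J k (powR_ge0 _ _)) _.
apply: ge0_le_integral; first exact: mJ.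
- by move=> t /J_gt0 t0; rewrite lee_fin divr_ge0 ?powR_ge0// ltW.
- exact: measurable_divJ.
- by apply: measurable_funeM; apply: mgJ => // t Jt; exists k.
- move=> t Jt; have t0 := J_gt0 Jt.
  rewrite -EFinM lee_fin mulrA ler_wpM2r ?invr_ge0 ?(ltW t0)//.
  rewrite -powRM ?g0//; apply: ge0_ler_powR; rewrite ?nnegrE ?(ltW q0)//.
    by rewrite mulr_ge0// g0.
  by move: Jt; rewrite /J /= in_itv/= => /andP[/ltW kt /ltW tk]; exact: band_le_g.
Qed.

Lemma weighted_le_besov f q : 0 < q ->
  (weighted_seq_norm a alpha q%:E (band E a f) <=
   (a `^ alpha * A * (1 - A^-1)^-1 `^ q^-1)%:E * besov_norm D alpha q%:E r f)%E.
Proof.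
move=> q0; have A10 : 0 < 1 - A^-1 by rewrite subr_gt0 invf_lt1.
have c0 : 0 <= a `^ alpha * A by rewrite mulr_ge0 ?powR_ge0// ltW.
have I0 : (0 <= \int[lebesgue_measure]_(t in `]0%R, +oo[) (g f t `^ q / t)%:E)%E.
  apply: integral_ge0 => t; rewrite /= in_itv/= andbT => t0.
  by rewrite lee_fin divr_ge0 ?powR_ge0// ltW.
have := series_le_integral f q0; rewrite -lee_pdivlMl// muleA -EFinM => h.
rewrite /besov_norm weighted_seq_normE.
apply: le_trans (ge0_le_poweR _ _ h) _.
- by rewrite invr_ge0 ltW.
- by apply: nneseries_ge0 => k _ _; rewrite lee_fin powR_ge0.
rewrite poweRM//; last first.
  by rewrite lee_fin mulr_ge0 ?powR_ge0// invr_ge0 ltW.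
have cq : ((a `^ alpha * A) `^ q) `^ q^-1 = a `^ alpha * A.
  by rewrite -powRrM mulfV ?lt0r_neq0// powRr1.
have A1V : 0 <= (1 - A^-1)^-1 by rewrite invr_ge0 ltW.
by rewrite poweR_EFin (powRM _ A1V (powR_ge0 _ _)) cq mulrC.
Qed.

Lemma weighted_le_besov_sup f :
  (weighted_seq_norm a alpha +oo (band E a f) <=
   (a `^ alpha * A)%:E * besov_norm D alpha +oo r f)%E.
Proof.
apply: ub_ereal_sup => _ [k _ <-].
have kt : 0 < A ^- k by rewrite invr_gt0 exprn_gt0.
(* For the supremum a single sample per band suffices, at t = A^-k. *)
have gS : ((g f (A ^- k))%:E <= besov_norm D alpha +oo r f)%E.
  by apply: ereal_sup_ubound; exists (A ^- k) => //; rewrite /= in_itv/= kt.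
apply: le_trans (_ : ((a `^ alpha * A)%:E * (g f (A ^- k))%:E <= _)%E); last first.
  by rewrite lee_wpmul2l// lee_fin mulr_ge0 ?powR_ge0// ltW.
rewrite -EFinM lee_fin; apply: band_le_g => //.
by rewrite ler_peMl// ltW.
Qed.

(** The lower estimate covers every band-limited expansion, the upper one the spectral bands, which
    serve as the witness for existence. *)
Lemma besov_equiv (q : \bar R) : (1 <= q)%E -> exists c1 c2 : R, [/\ 0 < c1, 0 < c2,
  forall u f, (forall k, P (a ^+ k) (u k) = u k) -> series u @ \oo --> f ->
    (c1%:E * besov_norm D alpha q r f <= weighted_seq_norm a alpha q u)%E &
  forall f, (weighted_seq_norm a alpha q (band E a f) <=
    c2%:E * besov_norm D alpha q r f)%E].
Proof.
have A10 : 0 < 1 - A^-1 by rewrite subr_gt0 invf_lt1.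
case: q => [q| |] //.
  rewrite lee_fin => q1; have q0 : 0 < q := lt_le_trans ltr01 q1.
  have c0 : 0 < C * e^-1 `^ q^-1 by rewrite mulr_gt0 ?powR_gt0 ?invr_gt0.
  exists (C * e^-1 `^ q^-1)^-1, (a `^ alpha * A * (1 - A^-1)^-1 `^ q^-1).
  split; first by rewrite invr_gt0.
  - by rewrite !mulr_gt0 ?powR_gt0 ?invr_gt0.
  - by move=> u f uP uf; rewrite lee_pdivrMl//; exact: besov_le_weighted.
  - by move=> f; exact: weighted_le_besov.
move=> _; exists C^-1, (a `^ alpha * A); split; first by rewrite invr_gt0.
- by rewrite mulr_gt0// powR_gt0.
- by move=> u f uP uf; rewrite lee_pdivrMl//; exact: besov_le_weighted_sup.
- exact: weighted_le_besov_sup.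
Qed.

End BesovNorm.

Unset Implicit Arguments.

Theorem theorem1p2 (R : realType) (H : completeNormedModType R[i])
    (form : {dot H for Num.conj}) (form_norm : induces_norm form)
    (L : unbounded_op H) (L_sa : self_adjoint form L)
    (L_pos : positive_definite form L)
    (D : unbounded_op H) (D_sqrt : is_positive_sqrt form D L)
    (E : set R -> H -> H) (E_D : spectral_measure_of form D E)
    (alpha : R) (alpha_gt0 : 0 < alpha)
    (q : \bar R) (q_ge1 : (1%:E <= q)%E)
    (a : R) (a_gt1 : 1 < a)
    (r : nat) (r_gt_alpha : alpha < r%:R) :
  exists c1 c2 : R, [/\ 0 < c1, 0 < c2 &
    forall f : H, besov D alpha q r f <->
      exists fk : nat -> H,
        [/\ forall k, Paley_Wiener E (a ^+ k) (fk k),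
            series fk @ \oo --> f,
            (weighted_seq_norm a alpha q fk < +oo)%E,
            (c1%:E * besov_norm D alpha q r f
               <= weighted_seq_norm a alpha q fk)%E &
            (weighted_seq_norm a alpha q fk
               <= c2%:E * besov_norm D alpha q r f)%E]].
Proof.
have [D_sa _ _ _] := D_sqrt.
have [c1 [c2 [c1_gt0 c2_gt0 c1P c2P]]] :=
  besov_equiv form_norm D_sa E_D alpha_gt0 a_gt1 r_gt_alpha q_ge1.
exists c1, c2; split=> // f; split=> [Bf|[fk [_ _ Wfk c1Bf _]]].
  have bandP k : E [set` `[0, a ^+ k]] (band E a f k) = band E a f k.
    exact: (band_proj E_D).
  have bandf := cvg_series_band form_norm E_D (f := f) a_gt1.
  exists (band E a f); split => //.
  - by move=> k; exists (band E a f k).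
  - by apply: le_lt_trans (c2P f) _; rewrite lte_mul_pinfty ?lee_fin ?ltW.
  - exact: c1P.
(* An infinite Besov norm, multiplied by c1 > 0, would force the sequence norm to be infinite. *)
rewrite /besov /= ltNge leye_eq; apply/negP => /eqP Bf.
move: c1Bf Wfk; rewrite Bf gt0_muley ?lte_fin// leye_eq => /eqP ->.
by rewrite ltxx.
Qed.
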